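(* Let $G$ be a graph and $H$ a minor of $G$. Then $\mathrm{xc}(\mathrm{CUT}^\square(G)) \geq \mathrm{xc}(\mathrm{CUT}^\square(H))$.
   Context: A graph $H$ is a minor of $G$ if $H$ can be obtained from $G$ by contracting edges, deleting edges and (isolated) vertices, and relabeling. For a graph $G=(V,E)$ and $S\subseteq V$, the cut vector $\delta_G(S)\in\mathbb{R}^E$ has $uv$-coordinate $1$ if $|S\cap\{u,v\}|=1$ and $0$ otherwise; $\mathrm{CUT}^\square(G)$ is the convex hull of all cut vectors of $G$. An extension of a polytope $P$ is a polytope $Q$ with $P$ the image of $Q$ under a linear map; its size is the number of facets of $Q$; $\mathrm{xc}(P)$ is the minimum size of an extension of $P$. *)

(* Defs.v *)
From HB Require Import structures.
From mathcomp Require Import all_boot all_order all_algebra.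
From mathcomp Require Import boolp classical_sets functions cardinality reals.
From mathcomp Require Import interval_inference convex.

Set Implicit Arguments.
Unset Strict Implicit.
Unset Printing Implicit Defensive.

Import Order.TTheory GRing.Theory Num.Theory.

Local Open Scope classical_set_scope.
Local Open Scope card_scope.
Local Open Scope ring_scope.

(** * Finite simple graphs and minors *)

Record sgraph : Type := SGraph {
  vertex :> finType;
  adj : rel vertex;
  adj_sym : symmetric adj;
  adj_irrefl : irreflexive adj }.

Definition giso (G H : sgraph) : Prop :=
  exists2 f : G -> H, bijective f & {mono f : x y / adj x y}.

Section MinorOperations.
Variable G : sgraph.

Definition del_edge_adj (u v : G) : rel G :=
  fun x y => adj x y && ([set x; y]%SET != [set u; v]%SET).

Lemma del_edge_sym u v : symmetric (del_edge_adj u v).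
Proof. by move=> x y; rewrite /del_edge_adj adj_sym finset.setUC. Qed.

Lemma del_edge_irrefl u v : irreflexive (del_edge_adj u v).
Proof. by move=> x; rewrite /del_edge_adj adj_irrefl. Qed.

Definition del_edge (u v : G) : sgraph :=
  SGraph (del_edge_sym u v) (del_edge_irrefl u v).

Definition isolated (v : G) : Prop := forall x : G, ~~ adj v x.

Definition del_vertex_adj (v : G) : rel {x : G | x != v} :=
  fun x y => adj (val x) (val y).

Lemma del_vertex_sym v : symmetric (@del_vertex_adj v).
Proof. by move=> x y; rewrite /del_vertex_adj adj_sym. Qed.

Lemma del_vertex_irrefl v : irreflexive (@del_vertex_adj v).
Proof. by move=> x; rewrite /del_vertex_adj adj_irrefl. Qed.

Definition del_vertex (v : G) : sgraph :=
  SGraph (@del_vertex_sym v) (@del_vertex_irrefl v).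

(** Contracting the edge [uv] merges [v] into [u]: the vertex [u] of the
    contraction stands for the merged vertex. The loop arising from [uv] is
    dropped and parallel edges are identified, so the result is simple. *)
Definition merge (u v x : G) : G := if x == v then u else x.

Definition contract_adj (u v : G) : rel {x : G | x != v} :=
  fun a b => (a != b) &&
    [exists x : G, exists y : G,
      [&& merge u v x == val a, merge u v y == val b & adj x y]].

Lemma contract_sym u v : symmetric (@contract_adj u v).
Proof.
suff imp a b : @contract_adj u v a b -> @contract_adj u v b a.
  by move=> a b; apply/idP/idP; apply: imp.
move=> /andP[ab /existsP[x /existsP[y /and3P[xa yb xy]]]].
rewrite /contract_adj eq_sym ab; apply/existsP; exists y; apply/existsP.
by exists x; rewrite xa yb adj_sym.
Qed.

Lemma contract_irrefl u v : irreflexive (@contract_adj u v).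
Proof. by move=> a; rewrite /contract_adj eqxx. Qed.

Definition contract (u v : G) : sgraph :=
  SGraph (@contract_sym u v) (@contract_irrefl u v).

End MinorOperations.

(** [minor G H]: the graph [H] is a minor of [G]. *)
Inductive minor (G : sgraph) : sgraph -> Prop :=
| minor_refl : minor G G
| minor_del_edge (H : sgraph) (u v : H) :
    minor G H -> adj u v -> minor G (del_edge u v)
| minor_del_vertex (H : sgraph) (v : H) :
    minor G H -> isolated v -> minor G (del_vertex v)
| minor_contract (H : sgraph) (u v : H) :
    minor G H -> adj u v -> minor G (contract u v)
| minor_relabel (H K : sgraph) :
    minor G H -> giso H K -> minor G K.

(** * Polytopes and extension complexity *)

Section Polytopes.
Context {R : realType} {V : lmodType R}.
Implicit Types P F : set V.

Definition convex_hull (A : set V) : set V := smallest (@convex_set R V) A.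

Definition polytope P : Prop :=
  exists2 A : set V, finite_set A & P = convex_hull A.

(** Faces are nonempty; [P] itself is a face (if nonempty), obtained from the
    trivial inequality [0 <= 0]. In particular a point has no facet. *)
Definition face P F : Prop :=
  exists (c : {scalar V}) (d : R),
    [/\ (forall x, P x -> c x <= d), F = P `&` [set x | c x = d] & F !=set0].

Definition facets P : set (set V) :=
  [set F | [/\ face P F, F <> P &
    forall F', face P F' -> F' <> P -> F `<=` F' -> F' = F]].

End Polytopes.

Section ExtensionComplexity.
Context {R : realType} {V : lmodType R}.
Implicit Type P : set V.

Definition extension m (Q : set 'rV[R]_m) P : Prop :=
  polytope Q /\ exists f : {linear 'rV[R]_m -> V}, f @` Q = P.

Definition extension_sizes P : set nat :=
  [set k | exists m (Q : set 'rV[R]_m), extension Q P /\ facets Q #= `I_k].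

(** The minimum of [extension_sizes P]. The default value [0] is irrelevant for
    polytopes, which always have an extension: see [xcP] below. *)
Definition xc P : nat :=
  xget 0%N [set k | extension_sizes P k /\ lbound (extension_sizes P) k].

End ExtensionComplexity.

Section ExtensionComplexityTheory.
Context {R : realType}.

Lemma convex_set_smallest (V : lmodType R) (A : set V) :
  convex_set (convex_hull A : set (convex_lmodType V)).
Proof.
move=> x y l; rewrite !inE => xA yA B /= [cB AB].
have := cB x y l; rewrite !inE; apply; [exact: xA | exact: yA].
Qed.

Lemma convex_hull_image (V W : lmodType R) (f : {linear V -> W}) (A : set V) :
  f @` convex_hull A = convex_hull (f @` A).
Proof.
apply/seteqP; split=> [_ [x xA <-]|].
  have : (f @^-1` convex_hull (f @` A)) x; last by [].
  apply: xA; split=> [a b l|a Aa]; last first.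
    by apply: sub_gen_smallest; exists a.
  rewrite !inE /= => fa fb.
  have := @convex_set_smallest W (f @` A) (f a) (f b) l.
  by rewrite !inE /= => /(_ fa fb); rewrite linearD !linearZ.
apply: smallest_sub => [a b l|_ [x Ax <-]]; last first.
  by exists x => //; apply: sub_gen_smallest.
rewrite !inE => -[x xA <-] [y yA <-].
exists (l%:num *: x + (1 - l%:num) *: y); last by rewrite linearD !linearZ.
by have := @convex_set_smallest V A x y l; rewrite !inE; apply.
Qed.

Lemma face_vertices (V : lmodType R) (A F1 F2 : set V) :
  face (convex_hull A) F1 -> face (convex_hull A) F2 ->
  F1 `&` A `<=` F2 -> F1 `<=` F2.
Proof.
move=> [c1 [d1 [c1P -> _]]] [c2 [d2 [_ -> _]]] sub x [xP /= c1x].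
split=> //=; pose C : set V :=
  [set y | convex_hull A y /\ (c1 y = d1 -> c2 y = d2)].
suff : C x by case=> _; apply.
apply: xP; split=> [a b l|a Aa]; last first.
  have aP : convex_hull A a by apply: sub_gen_smallest.
  by split=> // c1a; case: (sub a).
move=> aC bC; have [->|l0] := eqVneq l 0%:i01; first by rewrite conv0.
have [->|l1] := eqVneq l 1%:i01; first by rewrite conv1.
move: aC bC; rewrite !inE => -[aP Ca] [bP Cb]; split.
  by have := @convex_set_smallest V A a b l; rewrite !inE; apply.
have lgt0 : 0 < l%:num by rewrite lt_neqAle eq_sym l0 ge0.
have llt1 : 0 < 1 - l%:num by rewrite subr_gt0 lt_neqAle l1 le1.
have cE (c : {scalar V}) : c (l%:num *: a + (1 - l%:num) *: b) =
    l%:num * c a + (1 - l%:num) * c b by rewrite linearD !linearZ.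
have := c1P _ aP; have := c1P _ bP => c1b c1a.
have -> : (conv l a b : V) = l%:num *: a + (1 - l%:num) *: b by [].
rewrite !cE => e1.
have pa : 0 <= l%:num * (d1 - c1 a) by rewrite mulr_ge0 ?subr_ge0 // ltW.
have pb : 0 <= (1 - l%:num) * (d1 - c1 b) by rewrite mulr_ge0 ?subr_ge0 // ltW.
have /eqP : l%:num * (d1 - c1 a) + (1 - l%:num) * (d1 - c1 b) = 0.
  by rewrite !mulrBr addrACA -opprD e1 -mulrDl subrKC mul1r subrr.
rewrite paddr_eq0 // !mulf_eq0 !subr_eq0 (gt_eqF lgt0) /=.
rewrite -subr_eq0 -[1 == _]subr_eq0 (gt_eqF llt1) /= subr_eq0.
move=> /andP[/eqP ea /eqP eb]; rewrite Ca -?ea // Cb -?eb //.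
by rewrite -mulrDl subrKC mul1r.
Qed.

Lemma finite_facets (V : lmodType R) (P : set V) :
  polytope P -> finite_set (facets P).
Proof.
move=> [_ /finite_seqP[s ->] ->]; set P' := convex_hull _.
pose g (T : {set 'I_(size s)}) : set V :=
  xget set0 [set F | face P' F /\ forall i : 'I_(size s), F s`_i <-> i \in T].
apply: (@sub_finite_set _ _ (g @` setT)); last exact/finite_image/finite_finset.
move=> F [fF _ _]; exists [set i : 'I_(size s) | `[< F s`_i >]]%SET => //.
apply: xget_unique => [|F' [fF' eF']].
  by split=> // i; rewrite finset.inE; split=> /asboolP.
have sub i : F' s`_(i : 'I_(size s)) <-> F s`_i.
  by rewrite eF' finset.inE; split=> /asboolP.
apply/seteqP; split; apply: (face_vertices (A := [set` s])) => // x [Fx /= xs].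
  have ix : (index x s < size s)%N by rewrite index_mem.
  by have := (sub (Ordinal ix)).1; rewrite /= nth_index //; apply.
have ix : (index x s < size s)%N by rewrite index_mem.
by have := (sub (Ordinal ix)).2; rewrite /= nth_index //; apply.
Qed.

Lemma extension_sizes_nonempty (V : lmodType R) (P : set V) :
  polytope P -> extension_sizes P !=set0.
Proof.
move=> [_ /finite_seqP[s ->] ->].
pose Q : set 'rV[R]_(size s) := convex_hull (range (fun i => delta_mx 0 i)).
have pQ : polytope Q.
  exists (range (fun i : 'I_(size s) => delta_mx 0 i : 'rV[R]_(size s))) => //.
  exact/finite_image/finite_finset.
have /finite_setP[k Qk] := finite_facets pQ.
exists k, (size s), Q; split=> //; split=> //.
pose f (x : 'rV[R]_(size s)) : V := \sum_i x 0 i *: s`_i.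
have f_linear : linear f.
  move=> a x y; rewrite /f scaler_sumr -big_split; apply: eq_bigr => i _ /=.
  by rewrite !mxE scalerDl scalerA.
pose fL := GRing.isLinear.Build R 'rV[R]_(size s) V _ f f_linear.
pose F : {linear 'rV[R]_(size s) -> V} := HB.pack f fL.
have Fdelta i : F (delta_mx 0 i) = s`_i.
  rewrite /= /f (bigD1 i) //= big1 => [|j ji]; rewrite !mxE ?eqxx /=.
    by rewrite scale1r addr0.
  by rewrite (negbTE ji) scale0r.
exists F; rewrite convex_hull_image; congr convex_hull.
apply/seteqP; split=> [_ [_ [i _ <-] <-]|x /= xs].
  by rewrite Fdelta /= mem_nth.
have ix : (index x s < size s)%N by rewrite index_mem.
exists (delta_mx 0 (Ordinal ix)); first by exists (Ordinal ix).
by rewrite [LHS]Fdelta /= nth_index.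
Qed.

Lemma xcP (V : lmodType R) (P : set V) : polytope P ->
  extension_sizes P (xc P) /\ lbound (extension_sizes P) (xc P).
Proof.
move=> /extension_sizes_nonempty[k kP].
suff : exists n, extension_sizes P n /\ lbound (extension_sizes P) n.
  by move=> /(@xgetPex nat 0%N [set n | _ /\ lbound _ n]).
have ex : exists n, `[< extension_sizes P n >] by exists k; apply/asboolP.
exists (ex_minn ex); case: ex_minnP => n /asboolP nP nmin; split=> // j jP.
by rewrite leEnat; apply: nmin; apply/asboolP.
Qed.

End ExtensionComplexityTheory.

(** * The cut polytope *)

Section CutPolytope.
Variables (R : realType) (G : sgraph).

Definition edges : {set {set G}} :=
  [set [set p.1; p.2] | p : G * G & adj p.1 p.2]%SET.

Definition edge : finType := {e : {set G} | e \in edges}.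

Definition cut_vector (S : {set G}) : {ffun edge -> R^o} :=
  [ffun e => (#|S :&: val e|%SET == 1%N)%:R].

Definition cut_polytope : set {ffun edge -> R^o} :=
  convex_hull (range cut_vector).

Lemma polytope_cut_polytope : polytope cut_polytope.
Proof.
by exists (range cut_vector) => //; apply/finite_image/finite_finset.
Qed.

End CutPolytope.

Arguments cut_vector R {G} S.
Arguments cut_polytope R G : clear implicits.

(* Main.v *)
(** Extension complexity does not increase under linear images, nor when passing
    to a face: the preimage of a face under an extension is a face of the
    extension, and a face [F] of a polytope has at most as many facets as the
    polytope, since each facet of [F] is cut out of [F] by a facet of the
    polytope. Restricting edge coordinates projects CUT(G) onto the cut polytope
    of any subgraph, and projects the face [x_uv = 0] of CUT(G) onto the cut
    polytope of the contraction of [uv]. *)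

From HB Require Import structures.
Require Import Defs.
From mathcomp Require Import all_boot all_order all_algebra.
From mathcomp Require Import reals.
From mathcomp Require Import boolp classical_sets functions cardinality.
From mathcomp Require Import interval_inference convex ring lra.

Set Implicit Arguments.
Unset Strict Implicit.
Unset Printing Implicit Defensive.

Import Order.TTheory GRing.Theory Num.Theory.

Local Open Scope classical_set_scope.
Local Open Scope card_scope.
Local Open Scope ring_scope.

(** * Convex hulls and the faces they induce *)

Section ConvexHull.
Context {R : realType} {V : lmodType R}.
Implicit Types (A C P F : set V) (c : {scalar V}).

Lemma sub_convex_hull A : A `<=` convex_hull A.
Proof. exact: sub_gen_smallest. Qed.

Lemma convex_hull_conv A a b (t : R) : 0 < t < 1 ->
  convex_hull A a -> convex_hull A b -> convex_hull A (t *: a + (1 - t) *: b).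
Proof.
move=> /andP[t0 t1] Aa Ab.
have t01 : Itv.spec (@Itv.num_sem R) (Itv.Real `[0%Z, 1%Z]) t.
  by apply/and3P; split; rewrite ?num_real //= bnd_simp ltW.
have := @convex_set_smallest R V A a b (Itv.Def t01).
by rewrite !inE; apply.
Qed.

Lemma convex_hull_min A C :
  (forall a b (t : R), 0 < t < 1 -> C a -> C b -> C (t *: a + (1 - t) *: b)) ->
  A `<=` C -> convex_hull A `<=` C.
Proof.
move=> convC AC; apply: smallest_sub => // a b l aC bC.
have [->|l0] := eqVneq l 0%:i01; first by rewrite conv0.
have [->|l1] := eqVneq l 1%:i01; first by rewrite conv1.
move: aC bC; rewrite !inE => aC bC.
have l01 : 0 < l%:num < 1 by rewrite !lt_neqAle eq_sym l0 l1 ge0 le1.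
exact: convC l01 aC bC.
Qed.

Lemma convex_hull_le A c d :
  (forall a, A a -> c a <= d) -> forall x, convex_hull A x -> c x <= d.
Proof.
move=> cA x; apply: (@convex_hull_min _ [set y | c y <= d]) => //= a b t.
move=> /andP[t0 t1] ca cb; rewrite linearD !linearZ /=.
by nra.
Qed.

(** A valid inequality that is tight at a proper convex combination is tight at both end points, so
    points of [F] are combinations of generators in [F]. *)
Lemma convex_hull_face A F : face (convex_hull A) F ->
  F = convex_hull (A `&` F).
Proof.
move=> [c [d [cP FE _]]]; apply/seteqP; split=> [x|]; last first.
  apply: convex_hull_min => [a b t t01|a [] //].
  rewrite {}FE => -[Aa /= ca] [Ab /= cb]; split; first exact: convex_hull_conv.
  by rewrite /= linearD !linearZ /= ca cb; ring.
pose C := [set y | convex_hull A y /\ (c y = d -> convex_hull (A `&` F) y)].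
rewrite {1}FE => -[Ax /= cx]; suff [_] : C x by exact.
move: x Ax {cx}; apply: convex_hull_min => [a b t t01 [Aa Ca] [Ab Cb]|a Aa].
  split=> [|cab]; first exact: convex_hull_conv.
  move: (t01) (cP _ Aa) (cP _ Ab) => /andP[t0 t1] ca cb.
  move: cab; rewrite linearD !linearZ /= => cab.
  by apply: convex_hull_conv => //; [apply: Ca|apply: Cb]; nra.
have hAa := sub_convex_hull Aa.
by split=> // ca; apply: sub_convex_hull; split=> //; rewrite FE.
Qed.

(** * Faces of faces, and facets of a face *)

Lemma polytope_face P F : polytope P -> face P F -> polytope F.
Proof.
move=> [A Afin ->] /convex_hull_face FE; exists (A `&` F) => //.
exact: finite_setIl.
Qed.

Lemma scalar_combination (t : R) c c' :
  exists c'' : {scalar V}, forall x, c'' x = t * c x + c' x.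
Proof.
have lin : scalar (fun x => t * c x + c' x).
  by move=> a x y; rewrite !linearD !linearZ /=; ring.
pose linM := GRing.isLinear.Build R V R *%R (fun x => t * c x + c' x) lin.
by pose C : {scalar V} := HB.pack (fun x => t * c x + c' x) linM; exists C.
Qed.

Lemma seq_strict_ub (T : eqType) (s : seq T) (h : T -> R) :
  exists N, forall v, v \in s -> h v < N.
Proof.
elim: s => [|v s [N hN]]; first by exists 0.
exists (Num.max (h v + 1) N) => w; rewrite in_cons lt_max => /predU1P[->|/hN ->].
  by rewrite ltrDl ltr01.
by rewrite orbT.
Qed.

Lemma face_sub P F : face P F -> F `<=` P.
Proof. by move=> [c [d [_ -> _]]] x []. Qed.

(* If [c] defines [F] and [c'] defines [E] in [F], then [N c + c'] defines [E]
   in [P] for large [N]. *)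
Lemma face_trans P F E : polytope P -> face P F -> face F E -> face P E.
Proof.
move=> [A /finite_seqP[s ->] ->] fF [c' [d' [c'F EE En0]]].
move: (fF) => [c [d [cP FE _]]].
(* If [c v < d], then [h v < N] says exactly that [N c + c'] stays strictly below [N d + d'] at
   [v]. *)
pose h v := (c' v - d') / (d - c v).
have [N hN] := seq_strict_ub s h.
have [c'' c''E] := scalar_combination N c c'.
have c''P x : convex_hull [set` s] x -> c'' x <= N * d + d'.
  apply: convex_hull_le => {}x /= xs; rewrite c''E.
  have xP : convex_hull [set` s] x by exact: sub_convex_hull.
  have := cP _ xP; rewrite le_eqVlt => /predU1P[cx|cx].
    have /c'F : F x by rewrite FE.
    by rewrite cx lerD2l.
  have := hN _ xs; rewrite ltr_pdivrMr ?subr_gt0 // => hx; lra.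
have Eeq y : E y -> convex_hull [set` s] y /\ c'' y = N * d + d'.
  rewrite EE FE => -[[Py /= cy] /= c'y].
  by split=> //; rewrite c''E cy c'y.
have fE : face (convex_hull [set` s])
    (convex_hull [set` s] `&` [set x | c'' x = N * d + d']).
  exists c'', (N * d + d'); split=> //; case: En0 => y Ey.
  by exists y; apply: Eeq.
(* For this [N], tight generators lie in [F]; [face_vertices] passes this on to all tight points. *)
have sub : convex_hull [set` s] `&` [set x | c'' x = N * d + d'] `<=` F.
  apply: face_vertices fE fF _ => x [[xP /= c''x] /= xs].
  rewrite FE; split=> //=; apply/eqP; case: ltgtP (cP _ xP) => // cx _.
  have := hN _ xs; rewrite ltr_pdivrMr ?subr_gt0 // => hx.
  by move: c''x; rewrite c''E; lra.
suff -> : E = convex_hull [set` s] `&` [set x | c'' x = N * d + d'] by [].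
apply/seteqP; split=> y; first exact: Eeq.
move=> Hy; have Fy := sub _ Hy; rewrite EE; split=> //.
move: Hy Fy; rewrite FE => -[_ /=] + [_ /= cy].
by rewrite c''E cy => /addrI.
Qed.

(* Tilt the functional of [F] away from that of [F'] until it reaches a vertex
   of [P] outside [F']. *)
Lemma face_rotation P F F' x : polytope P -> face P F -> face P F' ->
  F `<=` F' -> F' <> P -> F' x -> ~ F x ->
  exists E, [/\ face P E, F `<=` E, ~ E x & E <> F].
Proof.
move=> [A /finite_seqP[s ->] ->] [c [d [cP FE Fn0]]] [c' [d' [c'P F'E F'n0]]].
move=> FF' F'P F'x Fx; set P' := convex_hull _ in cP FE c'P F'E F'P *.
have sP i : (i < size s)%N -> P' s`_i.
  by move=> ilt; apply: sub_convex_hull; rewrite /= mem_nth.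
(* If no generator were strictly below [d'], then [c' >= d'] on all of [P], and [F'] would be
   [P]. *)
have [i0 i0F'] : exists i : 'I_(size s), c' s`_i < d'.
  apply: contrapT => noi; apply: F'P; rewrite F'E; apply/seteqP; split=> y.
    by case.
  move=> yP; split=> //=; apply/eqP; rewrite eq_le c'P //=.
  rewrite -lerN2; pose c'N : {scalar V} := \- c'.
  move: y yP; apply: (@convex_hull_le _ c'N) => a /= asv.
  rewrite lerN2 leNgt; apply/negP => c'a; apply: noi.
  have ia : (index a s < size s)%N by rewrite index_mem.
  by exists (Ordinal ia); rewrite nth_index.
(* Ratio test: [c - t c' <= d - t d'] holds at a generator off [F'] iff [t] is at most its ratio
   [h]. The least ratio keeps the inequality valid and makes it tight at some generator outside
   [F']. *)
pose h (i : 'I_(size s)) := (d - c s`_i) / (d' - c' s`_i).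
case: (@arg_minP _ _ _ i0 (fun i : 'I_(size s) => c' s`_i < d') h i0F').
move=> i iF' imin; set t := h i in imin.
have [c'' c''E] := scalar_combination (- t) c' c.
have it : t * (d' - c' s`_i) = d - c s`_i.
  by rewrite /t /h divfK // subr_eq0 gt_eqF.
exists (P' `&` [set y | c'' y = - t * d' + d]); split.
- exists c'', (- t * d' + d); split=> //; last first.
    exists s`_i; split; first exact: sP.
    by rewrite /= c''E; lra.
  apply: convex_hull_le => y /= ys; rewrite c''E.
  have iy : (index y s < size s)%N by rewrite index_mem.
  have yP : P' y by rewrite -(nth_index 0 ys); apply: sP.
  have := c'P _ yP; rewrite le_eqVlt => /predU1P[->|c'y].
    by rewrite lerD2l; apply: cP.
  have := imin (Ordinal iy); rewrite /h /= nth_index // => /(_ c'y).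
  by rewrite ler_pdivlMr ?subr_gt0 // => ty; lra.
- move=> y Fy; have F'y := FF' _ Fy.
  move: F'y Fy; rewrite F'E FE => -[_ /= c'y] [yP /= cy].
  by split=> //=; rewrite c''E c'y cy.
- move=> [xP /=]; rewrite c''E; move: F'x; rewrite F'E => -[_ /= ->] /addrI cx.
  by apply: Fx; rewrite FE.
- move=> EF; have /FF' : F s`_i.
    by rewrite -EF; split; [exact: sP|rewrite /= c''E; lra].
  by rewrite F'E => -[_ /= e]; rewrite e ltxx in iF'.
Qed.

(** Induction on the number of generators outside [F]. If [F] is not a facet, it lies strictly
    inside a proper face [F']. Either [F'] avoids [x], or [face_rotation] yields another strictly
    larger face that does. *)
Lemma facet_avoiding P F x : polytope P -> face P F -> P x -> ~ F x ->
  exists K, [/\ facets P K, F `<=` K & ~ K x].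
Proof.
move=> pP; move: (pP) => [A /finite_seqP[s ->] PE] + Px.
pose out K := [set i : 'I_(size s) | `[< ~ K s`_i >]]%SET.
have [n] := ubnP #|out F|; elim: n F => // n IHn F Fn fF Fx.
(* A strictly larger face gains a generator, since faces containing the same generators coincide;
   hence the count drops. *)
have grow E : face P E -> F `<=` E -> ~ E x -> E <> F ->
    exists K, [/\ facets P K, F `<=` K & ~ K x].
  move=> fE FE Ex EF; have [] := IHn E _ fE Ex; last first.
    by move=> K [fK EK Kx]; exists K; split=> //; apply: subset_trans EK.
  apply: leq_trans (Fn : (#|out F| <= n)%N); apply: proper_card.
  apply/properP; split.
    apply/fintype.subsetP => i; rewrite !finset.inE => /asboolP Ei.
    apply/asboolP => Fi.
    exact: Ei (FE _ Fi).
  apply: contrapT => nex; apply: EF; apply/seteqP; split=> //.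
  rewrite PE in fE fF; apply: face_vertices fE fF _ => y [Ey /= ys].
  apply: contrapT => Fy; apply: nex.
  have iy : (index y s < size s)%N by rewrite index_mem.
  exists (Ordinal iy); rewrite finset.inE /= nth_index //; first exact/asboolP.
  by apply/asboolP; apply.
have [facetF|notfacet] := pselect (facets P F); first by exists F; split=> // y.
have FP : F <> P by move=> FP; rewrite FP in Fx.
have [F' [fF' F'P FF' F'F]] : exists F',
    [/\ face P F', F' <> P, F `<=` F' & F' <> F].
  apply: contrapT => nex; apply: notfacet; split=> // F' fF' F'P FF'.
  by apply: contrapT => F'F; apply: nex; exists F'.
have [F'x|/(grow F')] := pselect (F' x); last exact.
by have [E []] := face_rotation pP fF fF' FF' F'P F'x Fx; apply: grow.
Qed.

(* Every facet of the face [F] is [K `&` F] for some facet [K] of [P]. *)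
Lemma card_facets_face P F : polytope P -> face P F ->
  facets F #<= facets P.
Proof.
move=> pP fF; apply: card_le_trans (card_image_le (fun K => K `&` F) _).
apply: subset_card_le => E [fE EF Emax].
have [x Fx Ex] : exists2 x, F x & ~ E x.
  apply: contrapT => nex; apply: EF; apply/seteqP; split; first exact: face_sub.
  by move=> x Fx; apply: contrapT => Ex; apply: nex; exists x.
have [K [[fK KP Kmax] EK Kx]] :=
  facet_avoiding pP (face_trans pP fF fE) (face_sub fF Fx) Ex.
(* [K] misses the point [x] of [F], so [K] cuts out a proper face of [F] containing [E]; maximality
   of [E] makes them equal. *)
exists K => //; apply: Emax.
- move: fK => [c [d [cP KE _]]]; exists c, d; split.
  + by move=> y /(face_sub fF) /cP.
  + rewrite KE; apply/seteqP; split=> y; first by case=> -[].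
    by case=> Fy /= cy; split=> //; split=> //; apply: face_sub fF _ Fy.
  + have [_ [_ [_ _ [y Ey]]]] := fE.
    by exists y; split; [exact: EK|exact: face_sub fE _ Ey].
- by move=> KF; apply: Kx; rewrite -KF in Fx; case: Fx.
- by move=> y Ey; split; [exact: EK|exact: face_sub fE _ Ey].
Qed.

End ConvexHull.

(** * Monotonicity of extension complexity *)

Section ExtensionComplexityMonotonicity.
Context {R : realType}.

Lemma xc_linear_image (V W : lmodType R) (f : {linear V -> W}) (P : set V) :
  polytope P -> (xc (f @` P) <= xc P)%N.
Proof.
move=> pP; have pfP : polytope (f @` P).
  case: pP => A Afin ->; exists (f @` A); first exact: finite_image.
  exact: convex_hull_image.
have [[m [Q [[pQ [g gQ]] Qk]]] _] := xcP pP.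
have [_] := xcP pfP; apply; exists m, Q; split=> //; split=> //.
by exists (f \o g); rewrite -gQ image_comp.
Qed.

Lemma xc_face (V : lmodType R) (P F : set V) :
  polytope P -> face P F -> (xc F <= xc P)%N.
Proof.
move=> pP fF; have [[m [Q [[pQ [g gQ]] Qk]]] _] := xcP pP.
have [_ xcF] := xcP (polytope_face pP fF).
move: fF => [c [d [cP FE [y Fy]]]].
(* Pull the inequality defining [F] back along the projection [g] of a minimum extension [Q]. *)
pose Q' := Q `&` [set x | c (g x) = d].
have fQ' : face Q Q'.
  exists (c \o g), d; split=> // [x Qx|].
    by apply: cP; rewrite -gQ; exists x.
  move: Fy; rewrite FE -gQ => -[[x Qx <-] cx]; by exists x.
have pQ' := polytope_face pQ fQ'.
have /finite_setP[k Q'k] := finite_facets pQ'.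
have kle : (k <= xc P)%N.
  rewrite -card_le_II -(card_le_eql Q'k) -(card_le_eqr Qk).
  exact: card_facets_face.
apply: leq_trans kle; apply: xcF; exists m, Q'; split=> //; split=> //.
exists g; rewrite FE -gQ; apply/seteqP; split=> [_ [x [Qx /= cx] <-]|].
  by split=> //; exists x.
by move=> _ [[x Qx <-] cx]; exists x.
Qed.

End ExtensionComplexityMonotonicity.

(** * Cut polytopes under minor operations *)

Section CutPolytopeMinor.
Context {R : realType}.
Implicit Types G H K : sgraph.

Lemma mem_edges G (x y : G) : adj x y -> [set x; y]%SET \in edges G.
Proof. by move=> xy; apply/imsetP; exists (x, y); rewrite ?finset.inE. Qed.

Definition edge_of G (x y : G) (xy : adj x y) : edge G :=
  exist _ [set x; y]%SET (mem_edges xy).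

Lemma edgeP G (e : edge G) :
  exists x y (xy : adj x y), e = edge_of xy.
Proof.
have /imsetP[[x y] /= + exy] := valP e; rewrite finset.inE /= => xy.
by exists x, y, xy; apply: val_inj.
Qed.

Lemma cut_vector_edge G (S : {set G}) x y (xy : adj x y) :
  cut_vector R S (edge_of xy) = ((x \in S) != (y \in S))%:R.
Proof.
have xNy : x != y by apply/eqP => e; rewrite e adj_irrefl in xy.
rewrite ffunE /= finset.setIUr finset.setIC [X in _ :|: X]finset.setIC.
have I1 z : ([set z] :&: S = if z \in S then [set z] else finset.set0)%SET.
  case: ifP => zS; first by apply/finset.setIidPl; rewrite finset.sub1set.
  by apply/eqP; rewrite finset.setI_eq0 finset.disjoints1 zS.
rewrite !I1; case: ifP; case: ifP => _ _.
- by rewrite cards2 xNy.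
- by rewrite finset.setU0 cards1.
- by rewrite finset.set0U cards1.
- by rewrite finset.setU0 cards0.
Qed.

(** Common form of the subgraph and contraction cases: the cuts in [F] pull back along [iota] to all
    cuts of [K], and each edge of [K] has an edge of [H] that these cuts treat alike. Selecting
    those coordinates maps [F] onto the cut polytope of [K]. *)
Lemma xc_cut_face_proj H K (iota : K -> H) (F : set {ffun edge H -> R^o}) :
  face (cut_polytope R H) F ->
  (forall S : {set K}, exists2 T : {set H},
     F (cut_vector R T) & (iota @^-1: T)%SET = S) ->
  (forall a b, adj a b -> exists x y, adj x y /\
     forall T : {set H}, F (cut_vector R T) ->
       (x \in T) = (iota a \in T) /\ (y \in T) = (iota b \in T)) ->
  (xc (cut_polytope R K) <= xc (cut_polytope R H))%N.
Proof.
move=> fF lift ledge.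
have /choice[phi phiP] (e : edge K) : exists e' : edge H,
    forall T : {set H}, F (cut_vector R T) ->
      cut_vector R T e' = cut_vector R (iota @^-1: T)%SET e.
  have [a [b [ab ->]]] := edgeP e.
  have [x [y [xy xyP]]] := ledge a b ab; exists (edge_of xy) => T /xyP[xT yT].
  by rewrite !cut_vector_edge xT yT !finset.inE.
pose f (x : {ffun edge H -> R^o}) : {ffun edge K -> R^o} :=
  [ffun e => x (phi e)].
have f_linear : linear f by move=> a x y; apply/ffunP => e; rewrite !ffunE.
pose fL := GRing.isLinear.Build R _ _ _ f f_linear.
pose g : {linear {ffun edge H -> R^o} -> {ffun edge K -> R^o}} := HB.pack f fL.
have gcut T : F (cut_vector R T) ->
    g (cut_vector R T) = cut_vector R (iota @^-1: T)%SET.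
  by move=> FT; apply/ffunP => e; rewrite -phiP // ffunE.
have -> : cut_polytope R K = g @` F.
  rewrite (convex_hull_face fF) convex_hull_image; congr convex_hull.
  apply/seteqP; split=> [_ [S _ <-]|_ [_ [[T _ <-] FT] <-]].
    have [T FT <-] := lift S; exists (cut_vector R T); last exact: gcut.
    by split=> //; exists T.
  by rewrite gcut //; exists (iota @^-1: T)%SET.
have pH := polytope_cut_polytope R H.
apply: leq_trans (xc_face pH fF); apply: xc_linear_image.
exact: polytope_face fF.
Qed.

(** Here the face is the whole polytope, cut out by [0 <= 0]; by injectivity each [S] is the
    preimage of its image. *)
Lemma xc_cut_subgraph H K (iota : K -> H) : injective iota ->
  {homo iota : a b / adj a b} ->
  (xc (cut_polytope R K) <= xc (cut_polytope R H))%N.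
Proof.
move=> iota_inj iota_homo.
have cutP (T : {set H}) : cut_polytope R H (cut_vector R T).
  by apply: sub_convex_hull; exists T.
apply: (@xc_cut_face_proj _ _ iota (cut_polytope R H)) => [|S|a b ab].
- have zlin : scalar (fun _ : {ffun edge H -> R^o} => 0 : R).
    by move=> a x y; rewrite mulr0 addr0.
  pose zL := GRing.isLinear.Build R _ R *%R _ zlin.
  pose z : {scalar {ffun edge H -> R^o}} := HB.pack (fun _ => 0 : R) zL.
  exists z, 0; split=> //; last by exists (cut_vector R finset.set0).
  by apply/seteqP; split=> [x|x []].
- exists (iota @: S)%SET => //.
  by apply/setP => a; rewrite finset.inE mem_imset.
- by exists (iota a), (iota b); split; first exact: iota_homo.
Qed.

(** Cut vectors are nonnegative, so [- x e <= 0] is valid; the empty cut makes it tight. *)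
Lemma face_edge0 H (e : edge H) :
  face (cut_polytope R H) (cut_polytope R H `&` [set x | x e = 0]).
Proof.
have lin : scalar (fun x : {ffun edge H -> R^o} => - (x e : R)).
  by move=> a x y; rewrite !ffunE opprD -mulrN.
pose linM := GRing.isLinear.Build R _ R *%R _ lin.
pose c : {scalar {ffun edge H -> R^o}} :=
    HB.pack (fun x : {ffun edge H -> R^o} => - (x e : R)) linM.
exists c, 0; split.
- by apply: convex_hull_le => _ [T _ <-]; rewrite /c /= ffunE oppr_le0 ler0n.
- by apply/seteqP; split=> x [Px] /eqP;
    [rewrite -oppr_eq0|rewrite oppr_eq0] => /eqP.
- exists (cut_vector R finset.set0); split.
    by apply: sub_convex_hull; exists finset.set0.
  by rewrite /= ffunE finset.set0I cards0.
Qed.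

(* A cut has [x_uv = 0] iff it does not separate [u] from [v], i.e. iff it
   comes from a cut of the contraction. *)
Lemma xc_cut_contract H (u v : H) : adj u v ->
  (xc (cut_polytope R (contract u v)) <= xc (cut_polytope R H))%N.
Proof.
move=> uv; have uNv : u != v by apply/eqP => e; rewrite e adj_irrefl in uv.
have cut0 (T : {set H}) :
    (cut_polytope R H `&` [set x | x (edge_of uv) = 0]) (cut_vector R T) <->
    (u \in T) = (v \in T).
  split=> [[_ /= /eqP]|uvT].
    by rewrite cut_vector_edge pnatr_eq0 eqb0 negbK => /eqP.
  split; first by apply: sub_convex_hull; exists T.
  by rewrite /= cut_vector_edge uvT eqxx.
apply: (@xc_cut_face_proj _ (contract u v) val _ (face_edge0 (edge_of uv))).
  (* The lift puts [v] on the same side as [u]. *)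
  move=> S; exists [set x | Defs.merge u v x \in val @: S]%SET.
    by apply/cut0; rewrite !finset.inE /Defs.merge eqxx (negPf uNv).
  apply/setP => a; rewrite !finset.inE /Defs.merge (negPf (valP a)).
  by rewrite mem_imset //; apply: val_inj.
move=> a b /andP[_ /existsP[x /existsP[y /and3P[/eqP xa /eqP yb xy]]]].
(* An edge [xy] that induces [ab] serves: merging keeps membership in [T] when [u] and [v] are on
   the same side. *)
exists x, y; split=> // T /cut0 uvT.
by rewrite -xa -yb /Defs.merge; split; case: eqP => // ->.
Qed.

End CutPolytopeMinor.

Theorem theorem12 (R : realType) (G H : sgraph) (hminor : minor G H) :
  (xc (cut_polytope R G) >= xc (cut_polytope R H))%N.
Proof.
(* By transitivity, only the last operation has to be compared with the graph it acts on. *)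
elim: hminor => {H} [//|H u v _ IH _|H v _ IH _|H u v _ IH uv|H K _ IH HK];
  apply: leq_trans IH.
- by apply: (@xc_cut_subgraph _ H (del_edge u v) id) => // a b /andP[].
- by apply: (@xc_cut_subgraph _ H (del_vertex v) val) => //; apply: val_inj.
- exact: xc_cut_contract.
(* The inverse isomorphism embeds [K] in [H]. *)
- case: HK => f [g fK gK] fadj; apply: (@xc_cut_subgraph _ H K g).
    exact: can_inj gK.
  by move=> a b ab; rewrite -fadj !gK.
Qed.
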